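(* Let $G$ be a daisy cube properly embedded into $Q_n$. For $i\in\{1,\ldots,n\}$ let $E_i$ be the set of edges of $G$ using the direction $i$, so that $|E_i|$ is the number of such edges. Then the Wiener index $W(G)$ and the Mostar index $\mathit{Mo}(G)$ of $G$ are $$W(G)=|V(G)|\,|E(G)|-\sum_{i=1}^n |E_i|^2$$ and $$\mathit{Mo}(G)=|V(G)|\,|E(G)|-2\sum_{i=1}^n |E_i|^2.$$
   Context: Let $B=\{0,1\}$; elements of $B^n$ are written as binary strings $u=u_1\ldots u_n$. The hypercube $Q_n$ has vertex set $B^n$, two vertices being adjacent iff they differ in precisely one coordinate. An edge $uv$ of $Q_n$ uses the direction $i$ if $u$ and $v$ differ in coordinate $i$. The distance $d(u,v)$ between two vertices of a connected graph is the number of edges on a shortest $u,v$-path. A subgraph $G$ of a graph $H$ is isometric if the distance in $G$ between any two vertices of $G$ equals their distance in $H$. Let $\le$ be the partial order on $B^n$ with $u\le v$ iff $u_i\le v_i$ for all $i\in\{1,\ldots,n\}$. For $X\subseteq B^n$, the daisy cube generated by $X$ is $Q_n(X)$, the subgraph of $Q_n$ induced by $\{u\in B^n : u\le x \text{ for some } x\in X\}$. A graph $G$ is a daisy cube if there exist an isometric embedding of $G$ in some hypercube $Q_n$ and a subset $X\subseteq B^n$ such that (the image of) $G$ is the daisy cube $Q_n(X)$; such an embedding is called a proper embedding, and $G$ is then identified with its image. The Wiener index of a connected graph $G$ is $W(G)=\sum_{\{u,v\}\subset V(G)}d(u,v)$, the sum being over unordered pairs of vertices. For an edge $uv\in E(G)$,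 $n_{u,v}$ denotes the number of vertices of $G$ that are (strictly) closer to $u$ than to $v$. The Mostar index is $\mathit{Mo}(G)=\sum_{uv\in E(G)}|n_{u,v}-n_{v,u}|$, the sum being over the edges of $G$. *)

(* Defs.v *)
From mathcomp Require Import all_boot all_algebra.

Set Implicit Arguments.
Unset Strict Implicit.
Unset Printing Implicit Defensive.

Import GRing.Theory Num.Theory.

Record sgraph := SGraph {
  vertex :> finType;
  adj : rel vertex;
  adj_sym : symmetric adj;
  adj_irrefl : irreflexive adj }.

Section Graphs.
Variable G : sgraph.

(* The unordered pairs {u, v} with u != v, each one represented exactly once,
   namely by the ordered pair that is increasing for the enumeration of G;
   these representatives are only used with symmetric expressions. *)
Definition upairs : {set G * G} :=
  [set p | enum_rank p.1 < enum_rank p.2].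

Definition edges : {set G * G} := [set p in upairs | adj p.1 p.2].

Definition connected : Prop := forall u v : G, connect (@adj G) u v.

Definition walk (k : nat) (u v : G) : bool :=
  [exists p : k.-tuple G, path (@adj G) u p && (last u p == v)].

(* A shortest path has fewer than #|G| edges, so the search range suffices;
   the value is #|G| when u and v are not connected. *)
Definition gdist (u v : G) : nat :=
  find (fun k => walk k u v) (iota 0 #|G|).

Definition wiener : nat := \sum_(p in upairs) gdist p.1 p.2.

Definition ncloser (u v : G) : nat := #|[set w : G | gdist w u < gdist w v]|.

Definition mostar : int :=
  (\sum_(p in edges) `|(ncloser p.1 p.2)%:Z - (ncloser p.2 p.1)%:Z|)%R.

Section Induced.
Variable A : {set G}.

Definition induced_adj : rel {x : G | x \in A} :=
  fun u v => adj (val u) (val v).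

Lemma induced_adj_sym : symmetric induced_adj.
Proof. by move=> u v; apply: adj_sym. Qed.

Lemma induced_adj_irrefl : irreflexive induced_adj.
Proof. by move=> u; apply: adj_irrefl. Qed.

Definition induced : sgraph := SGraph induced_adj_sym induced_adj_irrefl.

End Induced.

End Graphs.

(* f identifies G with an isometric (in particular connected) subgraph of H. *)
Definition isometric_embedding (G H : sgraph) (f : G -> H) : Prop :=
  [/\ connected G,
      injective f,
      forall u v : G, adj u v -> adj (f u) (f v)
    & forall u v : G, gdist (f u) (f v) = gdist u v].

Section Hypercube.
Variable n : nat.

Definition uses_dir (u v : {ffun 'I_n -> bool}) (i : 'I_n) : bool :=
  u i != v i.

Definition cube_adj : rel {ffun 'I_n -> bool} :=
  fun u v => #|[set i | uses_dir u v i]| == 1.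

Lemma cube_adj_sym : symmetric cube_adj.
Proof.
by move=> u v; congr (_ == 1); apply: eq_card => i; rewrite !inE /uses_dir eq_sym.
Qed.

Lemma cube_adj_irrefl : irreflexive cube_adj.
Proof.
move=> u; rewrite /cube_adj (_ : [set i | _] = set0) ?cards0 //.
by apply/setP => i; rewrite !inE /uses_dir eqxx.
Qed.

Definition hypercube : sgraph := SGraph cube_adj_sym cube_adj_irrefl.

Definition cube_le (u v : {ffun 'I_n -> bool}) : bool :=
  [forall i, (u i <= v i)%N].

Definition daisy_set (X : {set hypercube}) : {set hypercube} :=
  [set u | [exists x in X, cube_le u x]].

End Hypercube.

Definition daisy_cube (n : nat) (X : {set hypercube n}) : sgraph :=
  induced (daisy_set X).

(* The image of G under f, as a subgraph of the hypercube, is a daisy cube: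
   f factors through an isomorphism from G onto Q_n(X). *)
Definition proper_embedding (G : sgraph) (n : nat) (f : G -> hypercube n) :
    Prop :=
  isometric_embedding f /\
  exists (X : {set hypercube n}) (g : G -> daisy_cube X),
    [/\ bijective g,
        forall u v : G, adj (g u) (g v) = adj u v
      & forall u : G, f u = sval (g u)].

Definition dir_edges (G : sgraph) (n : nat) (f : G -> hypercube n) (i : 'I_n) :
    {set G * G} :=
  [set p in edges G | uses_dir (f p.1) (f p.2) i].

(* Main.v *)
(* Distances in a properly embedded daisy cube are Hamming distances, so both
   indices split over the directions.  Let a_i be the number of vertices with
   i-th coordinate 1.  Clearing that coordinate stays inside the daisy cube, so
   |E_i| = a_i <= |V| - a_i.  Direction i separates a_i (|V| - a_i) pairs, and
   the vertices closer to an end u of an edge in E_i are those that agree with u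
   in coordinate i, so such an edge contributes |V| - 2 a_i to the Mostar
   index. *)

Require Import Defs.
From mathcomp Require Import all_boot all_algebra.
From mathcomp Require Import ring zify.

Set Implicit Arguments.
Unset Strict Implicit.
Unset Printing Implicit Defensive.

Import GRing.Theory Num.Theory.

(** * Hamming distance and shortest paths in the hypercube *)

Section Hamming.
Variable n : nat.
Implicit Types (u v w : hypercube n) (i : 'I_n).

Definition hamming u v : nat := \sum_(i < n) uses_dir u v i.

Definition flip i u : hypercube n := [ffun j => if j == i then ~~ u j else u j].

Lemma flip_inj i : injective (flip i).
Proof.
move=> u v /ffunP uv; apply/ffunP => j; have := uv j; rewrite !ffunE.
by case: eqP => // _ /negb_inj.
Qed.

Lemma cube_adjE u v : adj u v = (hamming u v == 1).
Proof. by rewrite /= /cube_adj -sum1dep_card big_mkcond. Qed.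

Lemma hamming_triangle u v w : hamming u w <= hamming u v + hamming v w.
Proof.
rewrite -big_split leq_sum // => i _; rewrite /uses_dir.
by case: (u i) (v i) (w i) => [] [] [].
Qed.

Lemma hamming_eq0 u v : (hamming u v == 0) = (u == v).
Proof.
rewrite sum_nat_eq0; apply/forallP/eqP => [uv|-> i]; last by rewrite /uses_dir eqxx.
by apply/ffunP => i; have := uv i; rewrite eqb0 negbK => /eqP.
Qed.

Lemma hamming_flip i u : hamming u (flip i u) = 1.
Proof.
rewrite /hamming (bigD1 i) //= big1 => [|j /negPf ji].
  by rewrite /uses_dir ffunE !eqxx; case: (u i).
by rewrite /uses_dir ffunE ji eqxx.
Qed.

(** Flipping a coordinate where [u] and [v] differ is one step towards [v]; this drives the
    construction of a shortest walk by induction. *)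
Lemma hamming_flip_dir i u v :
  uses_dir u v i -> hamming u v = (hamming (flip i u) v).+1.
Proof.
rewrite /hamming => uvi; rewrite (bigD1 i) //= [in RHS](bigD1 i) //= uvi.
rewrite [X in _ + _ = (X + _).+1](_ : _ = 0); last first.
  by move: uvi; rewrite /uses_dir ffunE eqxx; case: (u i) (v i) => [] [].
rewrite add0n add1n; congr _.+1; apply: eq_bigr => j /negPf ji.
by rewrite /uses_dir ffunE ji.
Qed.

Lemma walk_hamming u v k : walk k u v -> hamming u v <= k.
Proof.
case/existsP=> p /andP[+ /eqP<-]; rewrite -{3}(size_tuple p).
elim: {p}(tval p) u => [|x p IHp] u /=; first by rewrite leqn0 hamming_eq0.
case/andP; rewrite [cube_adj _ _]cube_adjE => /eqP ux /IHp xp.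
by rewrite (leq_trans (hamming_triangle _ x _)) // ux.
Qed.

Lemma hamming_walk u v : walk (hamming u v) u v.
Proof.
move: {1 3}(hamming u v) (erefl (hamming u v)) => k.
elim: k u => [|k IHk] u uvk.
  by apply/existsP; exists [tuple]; rewrite /= -hamming_eq0 -uvk.
have [i uvi] : exists i, uses_dir u v i.
  apply/existsP; apply: contraPT uvk; rewrite negb_exists => /forallP uv.
  by rewrite /hamming big1 // => i _; rewrite (negPf (uv i)).
move: uvk; rewrite (hamming_flip_dir uvi) => -[/IHk /existsP[p /andP[pp pv]]].
apply/existsP; exists [tuple of flip i u :: p]; rewrite /= pp pv !andbT.
by rewrite [cube_adj _ _]cube_adjE hamming_flip.
Qed.

Lemma gdist_hypercube u v : gdist u v = hamming u v.
Proof.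
(* The Hamming distance is at most n < 2^n, so it lies in the range searched by [gdist] and the
   default value of [find] is never reached. *)
have lt_card : hamming u v < #|hypercube n|.
  rewrite card_ffun card_bool card_ord.
  apply: (@leq_ltn_trans n); last exact: ltn_expl.
  rewrite -[leqRHS]card_ord -sum1_card; apply: leq_sum => i _.
  by case: uses_dir.
have has_walk : has (fun k => walk k u v) (iota 0 #|hypercube n|).
  by apply/hasP; exists (hamming u v); rewrite ?mem_iota ?hamming_walk.
have := has_walk; rewrite has_find size_iota => lt_find.
apply/eqP; rewrite eqn_leq; apply/andP; split.
  rewrite leqNgt; apply/negP => /(before_find 0).
  by rewrite nth_iota // hamming_walk.
by have := nth_find 0 has_walk; rewrite nth_iota // add0n => /walk_hamming.
Qed.

Lemma uses_dir_adj_uniq u v i j :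
  adj u v -> uses_dir u v i -> uses_dir u v j = (j == i).
Proof.
rewrite cube_adjE => /eqP uv1 uvi; have [->//|ji] := eqVneq j i.
by apply: contra_eqF uv1 => uvj; rewrite /hamming (bigD1 i) // (bigD1 j) //= uvi uvj.
Qed.

Lemma adj_flip u v i : (adj u v && uses_dir u v i) = (v == flip i u).
Proof.
apply/andP/eqP => [[uv uvi]|->].
  move: uv; rewrite cube_adjE (hamming_flip_dir uvi) eqSS hamming_eq0.
  by move/eqP->.
by rewrite cube_adjE hamming_flip /uses_dir ffunE !eqxx; case: (u i).
Qed.

(** The ends of an edge agree outside its direction, so only coordinate [i] can separate their
    distances to [w]. *)
Lemma hamming_lt_flip u v w i : adj u v -> uses_dir u v i ->
  (hamming w u < hamming w v) = (w i == u i).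
Proof.
move=> uv uvi; rewrite /hamming (bigD1 i) //= [ltnRHS](bigD1 i) //=.
rewrite [X in _ + X < _](eq_bigr (fun j => uses_dir w v j : nat)); last first.
  move=> j /negPf ji; have := uses_dir_adj_uniq j uv uvi.
  by rewrite ji /uses_dir => /negbFE/eqP->.
rewrite ltn_add2r; move: uvi; rewrite /uses_dir.
by case: (u i) (v i) (w i) => [] [] [].
Qed.

End Hamming.

(* Orients a symmetric summand, so that the sum no longer refers to the
   enumeration order that defines [upairs]. *)
Lemma sum_upairs (G : sgraph) (c : G -> G -> nat) :
  (forall u, c u u = 0) ->
  \sum_(p in upairs G) (c p.1 p.2 + c p.2 p.1) = \sum_u \sum_v c u v.
Proof.
move=> c0; rewrite big_split pair_big /=.
rewrite [RHS](bigID (mem (upairs G))) /=; congr (_ + _).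
rewrite [RHS](bigID (fun p => p.1 == p.2)) /=.
rewrite [X in _ = X + _]big1 ?add0n => [|[u v] /andP[_ /eqP/= ->] //].
rewrite (reindex_inj (can_inj (@swap_pairK G G))) /=.
apply: eq_bigl => -[u v]; rewrite !inE /= -leqNgt ltn_neqAle andbC.
by rewrite (inj_eq val_inj) (inj_eq enum_rank_inj) [v == u]eq_sym.
Qed.

(** * Counting by directions in a properly embedded daisy cube *)

Section DaisyCube.
Variables (G : sgraph) (n : nat) (f : G -> hypercube n).
Hypothesis f_proper : proper_embedding f.
Implicit Types (u v w : G) (i : 'I_n).

Definition ones i := [set u | f u i].

Lemma proper_inj : injective f.
Proof. by case: f_proper => [[]]. Qed.

Lemma proper_gdist u v : gdist u v = hamming (f u) (f v).
Proof. by case: f_proper => [[_ _ _ <-] _]; rewrite gdist_hypercube. Qed.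

Lemma proper_adj u v : adj (f u) (f v) = adj u v.
Proof. by case: f_proper => _ [X [g [_ <- fg]]]; rewrite !fg. Qed.

(** Turning a 1 into a 0 goes down in the order, so the result is still below the same generator;
    surjectivity of [g] then provides [v]. *)
Lemma proper_flip u i : f u i -> exists v, f v = flip i (f u).
Proof.
case: f_proper => _ [X [g [[h gK hK] _ fg]]] ui.
have flipX : flip i (f u) \in daisy_set X.
  have := valP (g u); rewrite -[val _]fg !inE.
  case/existsP=> x /andP[xX /forallP ux].
  apply/existsP; exists x; rewrite xX /=; apply/forallP => j.
  by rewrite ffunE; case: eqP => [->|_]; rewrite ?ui.
by exists (h (Sub (flip i (f u)) flipX : {x | x \in daisy_set X})); rewrite fg hK.
Qed.

Lemma card_dir_edges i : #|dir_edges f i| = #|ones i|.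
Proof.
(* Each edge of direction [i] is oriented away from its unique end with coordinate 1, so every
   vertex of [ones i] is the source of exactly one edge. *)
pose c u v : nat := [&& adj u v, uses_dir (f u) (f v) i & f u i].
have -> : #|dir_edges f i| = \sum_(p in upairs G) (c p.1 p.2 + c p.2 p.1).
  rewrite -sum1_card big_mkcond [RHS]big_mkcond; apply: eq_bigr => -[u v] _.
  rewrite /dir_edges /edges !inE /c /= (adj_sym v) /uses_dir.
  by case: ltnP; case: (adj u v) (f u i) (f v i) => [] [] [].
rewrite sum_upairs => [|u]; last by rewrite /c adj_irrefl.
rewrite -sum1_card [RHS]big_mkcond; apply: eq_bigr => u _; rewrite inE.
case: ifP => ui; last by rewrite big1 // => v _; rewrite /c ui !andbF.
have [v fv] := proper_flip ui.
rewrite (bigD1 v) //= big1 => [|w /negPf wv].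
  by rewrite /c ui andbT -proper_adj adj_flip fv eqxx.
by rewrite /c ui andbT -proper_adj adj_flip -fv (inj_eq proper_inj) wv.
Qed.

Lemma ones_le_cardC i : #|ones i| <= #|~: ones i|.
Proof.
(* [flip i] acts on the hypercube, so both sets are replaced by their images under [f]; it then
   injects the first into the second. *)
rewrite -!(card_imset _ proper_inj) -(card_imset _ (@flip_inj n i)).
apply/subset_leq_card/subsetP => _ /imsetP[_ /imsetP[u + ->] ->].
rewrite inE => ui; have [v fv] := proper_flip ui.
by rewrite -fv imset_f // !inE fv ffunE eqxx ui.
Qed.

Lemma card_edges : #|edges G| = \sum_(i < n) #|ones i|.
Proof.
(* The inner sum is the Hamming distance of the ends of an edge, hence 1. *)
transitivity (\sum_(p in edges G) \sum_(i < n) uses_dir (f p.1) (f p.2) i).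
  rewrite -sum1_card; apply: eq_bigr => p; rewrite !inE => /andP[_].
  by rewrite -proper_adj cube_adjE => /eqP.
rewrite exchange_big; apply: eq_bigr => i _.
rewrite -card_dir_edges -sum1_card [RHS]big_mkcond /= [LHS]big_mkcond /=.
by apply: eq_bigr => p _; rewrite !inE; do 3 case: (X in X && _) => //=.
Qed.

Lemma wiener_ones : wiener G = \sum_(i < n) #|ones i| * #|~: ones i|.
Proof.
rewrite /wiener; under eq_bigr do rewrite proper_gdist.
rewrite exchange_big; apply: eq_bigr => i _.
(* A pair separated by direction [i] is oriented from its 1-end to its 0-end, so the double sum
   counts a Cartesian product. *)
pose c u v : nat := f u i && ~~ f v i.
transitivity (\sum_(p in upairs G) (c p.1 p.2 + c p.2 p.1)).
  by apply: eq_bigr => -[u v] _; rewrite /uses_dir /c /=; case: (f u i) (f v i) => [] [].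
rewrite sum_upairs => [|u]; last by rewrite /c andbN.
rewrite -[#|ones i|]sum1_card big_distrl /= [RHS]big_mkcond.
apply: eq_bigr => u _; rewrite inE mul1n /c.
case: (f u i) => /=; last by rewrite big1.
rewrite -sum1_card [RHS]big_mkcond; apply: eq_bigr => v _.
by rewrite !inE; case: (f v i).
Qed.

Lemma ncloser_dir u v i : adj u v -> uses_dir (f u) (f v) i ->
  ncloser u v = if f u i then #|ones i| else #|~: ones i|.
Proof.
rewrite -proper_adj => uv uvi.
by case: ifP => ui; apply: eq_card => w; rewrite !inE !proper_gdist
  (hamming_lt_flip _ uv uvi) ui; case: (f w i).
Qed.

Local Open Scope ring_scope.

Lemma mostar_edge u v i : adj u v -> uses_dir (f u) (f v) i ->
  `|(ncloser u v)%:Z - (ncloser v u)%:Z| = #|G|%:Z - 2 * #|ones i|%:Z.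
Proof.
move=> uv uvi; have vui : uses_dir (f v) (f u) i by rewrite /uses_dir eq_sym.
rewrite (ncloser_dir uv uvi) (ncloser_dir _ vui) 1?adj_sym //.
(* The inequality fixes the sign of the difference, which removes the absolute value. *)
have := ones_le_cardC i; have := cardsC (ones i).
by move: uvi; rewrite /uses_dir; case: (f u i) (f v i) => [] [] //= _; lia.
Qed.

Lemma mostar_ones :
  mostar G = \sum_(i < n) #|ones i|%:Z * (#|G|%:Z - 2 * #|ones i|%:Z).
Proof.
(* An edge uses exactly one direction, so the inner sum has a single term; exchanging the sums then
   groups the edges by direction. *)
transitivity (\sum_(p in edges G) \sum_(i < n | uses_dir (f p.1) (f p.2) i)
                (#|G|%:Z - 2 * #|ones i|%:Z)).
  apply: eq_bigr => -[u v]; rewrite !inE /= => /andP[_ uv].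
  have [i uvi] : exists i, uses_dir (f u) (f v) i.
    move: uv; rewrite -proper_adj => /eqP/esym card1.
    have /card_gt0P[i] : (0 < #|[set i | uses_dir (f u) (f v) i]|)%N by rewrite -card1.
    by rewrite inE; exists i.
  rewrite (mostar_edge uv uvi) (big_pred1 i) // => j.
  by apply: uses_dir_adj_uniq; rewrite ?proper_adj.
rewrite (exchange_big_dep xpredT) //=; apply: eq_bigr => i _.
rewrite -card_dir_edges -[X in _ = (Posz X) * _]sum1_card.
rewrite -[in RHS]natz natr_sum big_distrl /=.
by apply: eq_big => [p|p _]; rewrite ?mul1r // !inE.
Qed.

End DaisyCube.

Theorem corollary4p1 (G : sgraph) (n : nat) (f : G -> hypercube n) :
  proper_embedding f ->
  ((wiener G)%:Z = #|G|%:Z * #|edges G|%:Z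
                   - \sum_(i < n) #|dir_edges f i|%:Z ^+ 2)%R
  /\ (mostar G = #|G|%:Z * #|edges G|%:Z
                 - 2%:Z * \sum_(i < n) #|dir_edges f i|%:Z ^+ 2)%R.
Proof.
move=> fP; rewrite (wiener_ones fP) (mostar_ones fP) (card_edges fP).
have sumZ (F : 'I_n -> nat) : ((\sum_i F i)%N%:Z = \sum_i (F i)%:Z)%R.
  by rewrite -natz natr_sum; apply: eq_bigr => i _; rewrite natz.
rewrite !sumZ !mulr_sumr -!sumrB.
split; apply: eq_bigr => i _; rewrite card_dir_edges //; last by ring.
(* With a + b = |V|, the Wiener term is a b = (a + b) a - a^2. *)
by rewrite -(cardsC (ones f i)) PoszM PoszD; ring.
Qed.
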